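(* Let $q\in\{5,11,17,23\}$ and let $L(q)$ be the ternary code of length $2q+2$ generated by $(I_{q+1},U_q)$. Then $L(q)$ contains exactly $4q+2$ codewords with all entries in $\{0,1\}$ and of Hamming weight $q+1$, and every such codeword is the incidence vector of a block of the Hadamard $3$-$(2q+2,q+1,(q-1)/2)$ design $D(q)$, where $D(q)$ is the design on the $2q+2$ coordinate positions whose blocks are, for each row $r$ of \[H=\begin{pmatrix} I_{q+1}-U_q^T & U_q+I_{q+1}\\ I_{q+1}+U_q^T & U_q-I_{q+1}\end{pmatrix}\] other than the first (all-one) row, the two sets $\{j:r_j=1\}$ and $\{j:r_j=-1\}$.
   Context: All codes are over $GF(3)$; $-1$ is identified with $2$. For an odd prime power $q$ with $q\equiv -1\pmod 3$, $S_q=(s_{i,j})$ is the $(q+1)\times(q+1)$ matrix with rows and columns labeled by $\infty$ and the elements of $GF(q)$, where $s_{\infty,\infty}=0$, $s_{a,a}=0$, $s_{\infty,a}=1$ for $a\in GF(q)$, $s_{a,\infty}=1$ if $-1$ is a square in $GF(q)$ and $s_{a,\infty}=-1$ otherwise, and for $a\neq b$ in $GF(q)$, $s_{a,b}=1$ if $a-b$ is a square in $GF(q)$ and $s_{a,b}=-1$ otherwise. $U_q$ is obtained from $S_q$ by replacing every nonzero entry in the column labeled $\infty$ by $-1$. $L(q)$ is the ternary code with generator matrix $(I_{q+1},U_q)$; $H$ is a Hadamard matrix of order $2q+2$ whose rows are codewords of $L(q)$. *)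

(* Defs.v *)
From HB Require Import structures.
From mathcomp Require Import all_boot all_order all_algebra.

Set Implicit Arguments.
Unset Strict Implicit.
Unset Printing Implicit Defensive.

Import GRing.Theory.
Local Open Scope ring_scope.

Section Matrices.
Variable F : finFieldType.

(* None is the label oo; it is attached to the index 0, and the
   remaining indices run through F in its canonical enumeration. *)
Definition label (i : 'I_#|F|.+1) : option F := omap enum_val (unlift ord0 i).

Definition is_square (a : F) : bool := [exists b : F, a == b ^+ 2].

(* The entries 0, 1, -1 are read in an arbitrary ring, so that the same matrix
   can be used over 'F_3 (for the code) and over int (for H). *)
Definition S_entry (R : nzRingType) (x y : option F) : R :=
  match x, y with
  | None, None => 0
  | None, Some _ => 1
  | Some _, None => if is_square (-1) then 1 else -1
  | Some a, Some b =>
      if a == b then 0 else if is_square (a - b) then 1 else -1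
  end.

Definition S_mx (R : nzRingType) : 'M[R]_(#|F|.+1) :=
  \matrix_(i, j) S_entry R (label i) (label j).

Definition U_mx (R : nzRingType) : 'M[R]_(#|F|.+1) :=
  \matrix_(i, j)
    if (label j == None) && (S_mx R i j != 0) then -1 else S_mx R i j.

Definition L_code : {set 'rV['F_3]_(#|F|.+1 + #|F|.+1)} :=
  [set c | (c <= row_mx 1%:M (U_mx 'F_3))%MS].

Definition H_mx : 'M[int]_(#|F|.+1 + #|F|.+1) :=
  let U := U_mx int in
  block_mx (1%:M - U^T) (U + 1%:M)
           (1%:M + U^T) (U - 1%:M).

Definition H_level (r : 'I_(#|F|.+1 + #|F|.+1)) (e : int) :
  {set 'I_(#|F|.+1 + #|F|.+1)} := [set j | H_mx r j == e].

Definition D_blocks : {set {set 'I_(#|F|.+1 + #|F|.+1)}} :=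
  let rows := [set r : 'I_(#|F|.+1 + #|F|.+1) | val r != 0%N] in
  [set H_level r 1 | r in rows] :|: [set H_level r (-1) | r in rows].

Lemma H_mx_first_row r j : val r = 0%N -> H_mx r j = 1.
Proof.
move=> r0; have -> : r = lshift _ ord0 by apply/val_inj.
have lab0 : label ord0 = None by rewrite /label unlift_none.
have labS k : label (lift ord0 k) = Some (enum_val k) by rewrite /label liftK.
rewrite /H_mx -(splitK j); case: (split j) => k /=.
  rewrite block_mxEul !mxE; case: (unliftP ord0 k) => [l|] ->.
    by rewrite lab0 labS /=; case: is_square.
  by rewrite lab0.
rewrite block_mxEur !mxE; case: (unliftP ord0 k) => [l|] ->.
  by rewrite lab0 labS.
by rewrite lab0.
Qed.

End Matrices.

Definition hamming_weight (R : nzRingType) n (c : 'rV[R]_n) : nat :=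
  #|[set j | c 0 j != 0]|.

Definition zero_one (R : nzRingType) n (c : 'rV[R]_n) : bool :=
  [forall j, (c 0 j == 0) || (c 0 j == 1)].

Definition incidence_vector (R : nzRingType) n (B : {set 'I_n}) : 'rV[R]_n :=
  \row_j (j \in B)%:R.

Definition is_design (T : finType) (t v k lambda : nat)
    (blocks : {set {set T}}) : Prop :=
  [/\ #|T| = v,
      forall B, B \in blocks -> #|B| = k
    & forall X : {set T}, #|X| = t ->
        #|[set B in blocks | X \subset B]| = lambda].

(* Main.v *)
Require Import Defs.
From mathcomp Require Import all_boot all_order all_algebra.
From mathcomp Require Import finfield.
From mathcomp Require Import ring zify.

(** Counting the solutions of v^2 - u^2 = d gives the autocorrelation of the
    quadratic character, hence U U^T = U^T U = q I over the integers, and H is a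
    Hadamard matrix with constant first row.  Orthogonality of its columns is the
    3-design property, orthogonality of its rows makes the 4q+2 blocks distinct
    of size q+1.  As q = -1 mod 3, the rows of H reduce to the words
    (I -+ U^T)(I, U) of L(q), so the incidence vectors of the blocks are 4q+2 of
    the required codewords, and it remains to see that there are no others.  If c
    is such a codeword then 1 + c is a codeword without zero entries, with as many
    entries 1 as -1.  These are counted by a tree search which assigns the
    coordinates one after the other in a suitable order; a coordinate depending
    linearly on the previous ones leaves no choice, and its vanishing prunes the
    branch. *)

Set Implicit Arguments.
Unset Strict Implicit.
Unset Printing Implicit Defensive.

Import GRing.Theory Num.Theory.

(** * The Hadamard matrix and its design *)

Local Open Scope ring_scope.

(** * The quadratic character and the integer matrices [U] and [H] *)

Section Paley.
Variable F : finFieldType.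
Hypothesis two_neq0 : 2%:R != 0 :> F.

Definition chi (a : F) : int :=
  if a == 0 then 0 else if is_square a then 1 else -1.

(** A nonzero square has the two roots [b] and [- b], distinct because 2 is nonzero in [F]. *)
Lemma card_sqrt (a : F) : #|[set u | u ^+ 2 == a]|%:Z = 1 + chi a.
Proof.
rewrite /chi; have [->|a0] := eqVneq a 0.
  rewrite addr0 (_ : [set u | _] = [set 0]) ?cards1 //.
  by apply/setP=> u; rewrite !inE sqrf_eq0.
case: ifPn => [/existsP[b /eqP ab]|nsq].
  have nb : b != - b.
    rewrite -subr_eq0 opprK -mulr2n -mulr_natr mulf_neq0 ?two_neq0 //.
    by apply: contraNneq a0 => b0; rewrite ab b0 expr0n.
  rewrite (_ : [set u | _] = [set b; - b]) ?cards2 ?nb //.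
  by apply/setP=> u; rewrite !inE ab eqf_sqr.
rewrite (_ : [set u | _] = set0) ?cards0 //.
apply/setP=> u; rewrite !inE; apply: contraNF nsq => /eqP <-.
by apply/existsP; exists u.
Qed.

(** Grouping the [u] by their squares. Through [card_sqrt], the left side becomes a character
    sum. *)
Lemma sum_card_sqrt (f : F -> int) :
  \sum_a #|[set u | u ^+ 2 == a]|%:Z * f a = \sum_u f (u ^+ 2).
Proof.
rewrite [RHS](partition_big (fun u => u ^+ 2) xpredT) //=.
apply: eq_bigr => a _; rewrite (eq_bigr (fun=> f a)) => [|u /eqP->//].
by rewrite sumr_const -mulr_natl cardsE pmulrn intz.
Qed.

Lemma sum_chi : \sum_a chi a = 0.
Proof.
have := sum_card_sqrt (fun=> 1).
under eq_bigr do rewrite mulr1 card_sqrt.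
by rewrite big_split /= => /eqP; rewrite -subr_eq0 addrAC subrr add0r => /eqP.
Qed.

(* Double count of the solutions of [v ^+ 2 = u ^+ 2 + d]; the factorisation
   [(v - u) * (v + u) = d] parametrises them by [v - u != 0]. *)
Lemma sum_chi_shift (d : F) : d != 0 -> \sum_a chi a * chi (a + d) = -1.
Proof.
move=> d0.
have shift0 : \sum_a chi (a + d) = 0.
  by rewrite -[RHS]sum_chi; rewrite [RHS](reindex_inj (addIr d)).
have count : \sum_u #|[set v | v ^+ 2 == u ^+ 2 + d]|%:Z = (#|F|.-1)%:Z.
  pose A u := [set v : F | v ^+ 2 == u ^+ 2 + d].
  rewrite -(big_morph Posz PoszD (erefl 0)); congr Posz.
  have -> : (\sum_u #|A u| = #|[set p : F * F | p.2 \in A p.1]|)%N.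
    rewrite -sum1_card (eq_bigl (fun p : F * F => p.2 \in A p.1)).
      rewrite -(pair_big_dep xpredT (fun u v => v \in A u) (fun _ _ => 1%N)) /=.
      by apply: eq_bigr => u _; rewrite sum1_card.
    by move=> p; rewrite inE.
  rewrite -(cardC1 (0 : F)).
  (* This is the solution [(u, v)] of [v - u = t] and [v + u = d / t]. *)
  pose g (t : F) : F * F := ((d / t - t) / 2%:R, (d / t + t) / 2%:R).
  have g_inj : {in predC1 0 &, injective g}.
    move=> t t' _ _ [e1 e2].
    have: ((d / t + t) / 2%:R) - ((d / t - t) / 2%:R) =
          ((d / t' + t') / 2%:R) - ((d / t' - t') / 2%:R) by rewrite e1 e2.
    have aux (x y : F) : (x + y) / 2%:R - (x - y) / 2%:R = y by field.
    by rewrite !aux.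
  rewrite -(card_in_image g_inj); apply: eq_card => -[u v] /=.
  rewrite !inE /=; apply/eqP/imageP => [uv|[t t0 [-> ->]]].
    have fac : (v - u) * (v + u) = d by rewrite -subr_sqr uv addrAC subrr add0r.
    have vu0 : v - u != 0 by apply: contraNneq d0 => e; rewrite -fac e mul0r.
    exists (v - u) => //; rewrite /g -fac.
    by congr (_, _); field; rewrite vu0 two_neq0.
  rewrite inE in t0; by field; rewrite t0 two_neq0.
(* The left side is the sum of [(1 + chi a) * (1 + chi (a + d))], that is [q] plus the sum sought;
   by [count] the right side is [q - 1]. *)
have := sum_card_sqrt (fun a => #|[set v | v ^+ 2 == a + d]|%:Z).
rewrite count; under eq_bigr do rewrite !card_sqrt mulrDl mul1r mulrDr mulr1.
rewrite !big_split /= sum_chi shift0 sumr_const.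
rewrite addr0 add0r; have : (0 < #|F|)%N by apply/card_gt0P; exists 0.
case: #|F| => // n _ /=; rewrite natz => e.
by rewrite -[LHS](addKr n.+1%:Z) e; lia.
Qed.

Lemma sum_chi_sqr : \sum_a chi a * chi a = #|F|%:Z - 1.
Proof.
rewrite (bigD1 0) //= {1}/chi eqxx mul0r add0r.
rewrite (eq_bigr (fun=> 1)) => [|a /negPf a0]; last first.
  by rewrite /chi a0; case: ifP; rewrite ?mulrNN mulr1.
rewrite sumr_const cardC1 natz.
have : (0 < #|F|)%N by apply/card_gt0P; exists 0.
by case: #|F| => //= n _; lia.
Qed.

Lemma sum_chi_autocorrelation (d : F) :
  \sum_a chi a * chi (a + d) = #|F|%:Z *+ (d == 0) - 1.
Proof.
have [->|/sum_chi_shift->] := eqVneq d 0; last by rewrite mulr0n add0r.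
by under eq_bigr do rewrite addr0; rewrite sum_chi_sqr mulr1n.
Qed.

(** Since the column of oo is set to -1, whether -1 is a square no longer matters in it. *)
Definition U_entry (x y : option F) : int :=
  match x, y with
  | None, None => 0
  | None, Some _ => 1
  | Some _, None => -1
  | Some a, Some b => chi (a - b)
  end.

Lemma U_mxE i j : U_mx F int i j = U_entry (label i) (label j).
Proof.
rewrite !mxE; case: (label i) (label j) => [a|] [b|] //=.
  by rewrite /chi subr_eq0.
by case: is_square.
Qed.

Lemma sum_label (f : option F -> int) :
  \sum_i f (label i) = f None + \sum_a f (Some a).
Proof.
rewrite big_ord_recl /label unlift_none; congr (_ + _).
rewrite [RHS](reindex_onto (fun i : 'I_#|F| => enum_val i) enum_rank) /=.
  apply: eq_big => [i|i _]; first by rewrite enum_valK eqxx.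
  by rewrite liftK.
by move=> a _; rewrite enum_rankK.
Qed.

Lemma label_inj : injective (@label F).
Proof.
move=> i j; rewrite /label.
case: unliftP => [k ->|->]; case: unliftP => [l ->|->] //=.
by case=> /enum_val_inj ->.
Qed.

(** For two finite labels the column oo contributes [(-1) * (-1) = 1], which cancels the -1 of the
    autocorrelation. The row oo meets a finite row in a full sum of [chi], which is 0. *)
Lemma U_mulmx_tr : U_mx F int *m (U_mx F int)^T = #|F|%:Z%:M.
Proof.
apply/matrixP=> i j; rewrite !mxE -(inj_eq label_inj).
under eq_bigr do rewrite [_^T _ _]mxE !U_mxE.
rewrite (sum_label (fun z => U_entry _ z * U_entry _ z)).
case: (label i) (label j) => [a|] [b|] /=.
- rewrite (reindex_inj (subrI a)) /=.
  under eq_bigr do rewrite subKr opprB addrC -addrA.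
  rewrite sum_chi_autocorrelation [- a + b]addrC subr_eq0 eq_sym.
  by rewrite (inj_eq (@Some_inj _)) mulrNN mulr1 addrC subrK.
- rewrite -mulr_suml (reindex_inj (subrI a)) /=.
  by under eq_bigr do rewrite subKr; rewrite sum_chi mulr0 mul0r.
- rewrite -mulr_sumr (reindex_inj (subrI b)) /=.
  by under eq_bigr do rewrite subKr; rewrite sum_chi mulr0 mul0r.
- by rewrite mulr0 add0r mulr1 sumr_const natz.
Qed.

Lemma U_trmx_mul : (U_mx F int)^T *m U_mx F int = #|F|%:Z%:M.
Proof.
apply/matrixP=> i j; rewrite !mxE -(inj_eq label_inj).
under eq_bigr do rewrite [_^T _ _]mxE !U_mxE.
rewrite (sum_label (fun z => U_entry z _ * U_entry z _)).
case: (label i) (label j) => [a|] [b|] /=.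
- rewrite (reindex_inj (addIr a)) /=.
  under eq_bigr do rewrite addrK -addrA.
  rewrite sum_chi_autocorrelation subr_eq0 (inj_eq (@Some_inj _)).
  by rewrite mulr1 addrC subrK.
- rewrite -mulr_suml (reindex_inj (addIr a)) /=.
  by under eq_bigr do rewrite addrK; rewrite sum_chi mulr0 mul0r.
- rewrite -mulr_sumr (reindex_inj (addIr b)) /=.
  by under eq_bigr do rewrite addrK; rewrite sum_chi mulr0 mul0r.
- by rewrite mul0r add0r mulrNN mulr1 sumr_const natz.
Qed.

Lemma H_mulmx_tr : H_mx F *m (H_mx F)^T = (#|F|.+1 + #|F|.+1)%:Z%:M.
Proof.
rewrite /H_mx tr_block_mx mulmx_block !(linearD, linearN) /= !trmx1 trmxK.
rewrite !(mulmxDl, mulmxDr, mulmxN, mulNmx, mulmx1, mul1mx).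
rewrite U_mulmx_tr U_trmx_mul scalar_mx_block.
move: (U_mx F int)^T (U_mx F int) => V U.
by congr block_mx; apply/matrixP=> i j; rewrite !mxE; case: (i == j);
  rewrite ?mulr1n ?mulr0n /=; lia.
Qed.

Lemma H_trmx_mul : (H_mx F)^T *m H_mx F = (#|F|.+1 + #|F|.+1)%:Z%:M.
Proof.
rewrite /H_mx tr_block_mx mulmx_block !(linearD, linearN) /= !trmx1 trmxK.
rewrite !(mulmxDl, mulmxDr, mulmxN, mulNmx, mulmx1, mul1mx).
rewrite U_mulmx_tr U_trmx_mul scalar_mx_block.
(* Here the squares of [U] and of its transpose also occur, in the off-diagonal blocks, where they
   cancel. *)
move: (U_mx F int *m U_mx F int) => UU.
move: ((U_mx F int)^T *m (U_mx F int)^T) => VV.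
move: (U_mx F int)^T (U_mx F int) => V U.
by congr block_mx; apply/matrixP=> i j; rewrite !mxE; case: (i == j);
  rewrite ?mulr1n ?mulr0n /=; lia.
Qed.

Lemma U_offdiag_pm1 k l :
  if k == l then U_mx F int k l = 0
  else U_mx F int k l = 1 \/ U_mx F int k l = -1.
Proof.
rewrite U_mxE -(inj_eq label_inj); case: (label k) (label l) => [a|] [b|] //=.
- by rewrite (inj_eq (@Some_inj _)) /chi subr_eq0; case: eqP => // _;
    case: is_square; [left|right].
- by right.
- by left.
Qed.

(** In each block the identity fills exactly the zero diagonal of [U]. *)
Lemma H_pm1 i j : H_mx F i j = 1 \/ H_mx F i j = -1.
Proof.
rewrite /H_mx; move: (U_mx F int) U_offdiag_pm1 => U Upm.
rewrite -(splitK i) -(splitK j); case: (split i) (split j) => k [] l /=;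
  rewrite ?(block_mxEul, block_mxEur, block_mxEdl, block_mxEdr) !mxE.
- have := Upm l k; rewrite eq_sym.
  by case: eqP => _ /=; rewrite ?mulr1n ?mulr0n; lia.
- by have := Upm k l; case: eqP => _ /=; rewrite ?mulr1n ?mulr0n; lia.
- have := Upm l k; rewrite eq_sym.
  by case: eqP => _ /=; rewrite ?mulr1n ?mulr0n; lia.
- by have := Upm k l; case: eqP => _ /=; rewrite ?mulr1n ?mulr0n; lia.
Qed.

End Paley.

(** * The 3-design of a Hadamard matrix with an all-one row *)

Section HadamardDesign.
Variables (m : nat) (H : 'M[int]_m) (r0 : 'I_m).
Hypothesis H_pm1 : forall i j, H i j = 1 \/ H i j = -1.
Hypothesis H_rows : H *m H^T = m%:Z%:M.
Hypothesis H_cols : H^T *m H = m%:Z%:M.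
Hypothesis H_r0 : forall j, H r0 j = 1.

Definition level (p : 'I_m * bool) : {set 'I_m} :=
  [set j | H p.1 j == (-1) ^+ p.2].

(** The constant row is left out: its level sets are the whole set and the empty set. *)
Definition levels : {set {set 'I_m}} := level @: setX [set~ r0] setT.

Lemma row_dot i k : \sum_j H i j * H k j = m%:Z *+ (i == k).
Proof.
have /matrixP/(_ i k) := H_rows; rewrite !mxE => <-.
by apply: eq_bigr => j _; rewrite mxE.
Qed.

Lemma col_dot j l : \sum_i H i j * H i l = m%:Z *+ (j == l).
Proof.
have /matrixP/(_ j l) := H_cols; rewrite !mxE => <-.
by apply: eq_bigr => i _; rewrite mxE.
Qed.

(** Membership becomes affine in the entries of [H], so that counting reduces to dot products. *)
Lemma levelE p j : (j \in level p)%:Z *+ 2 = 1 + (-1) ^+ p.2 * H p.1 j.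
Proof. by rewrite inE; case: (H_pm1 p.1 j) => ->; case: p.2. Qed.

Lemma level_row (p : 'I_m * bool) j :
  H p.1 j = (-1) ^+ p.2 * ((j \in level p)%:Z *+ 2 - 1).
Proof. by rewrite levelE addrAC subrr add0r mulrA -expr2 sqrr_sign mul1r. Qed.

(** A level set with its sign determines the row, so equal level sets give rows equal up to sign.
    Orthogonality forces a single row, and any of its entries then fixes the sign. *)
Lemma level_inj : injective level.
Proof.
have m_gt0 : (0 < m)%N by case: (m) r0 => // -[].
move=> p p' eq_l.
have rowE j : H p.1 j = (-1) ^+ p.2 * (-1) ^+ p'.2 * H p'.1 j.
  rewrite level_row (level_row p') eq_l -!mulrA; congr (_ * _).
  by rewrite !mulrA -expr2 sqrr_sign mul1r.
have eq1 : p.1 = p'.1.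
  apply/eqP; apply: contraT => ne; have := row_dot p.1 p'.1.
  under eq_bigr do rewrite rowE -!mulrA.
  rewrite -!mulr_sumr row_dot eqxx (negPf ne) mulr0n => /eqP.
  by rewrite !mulf_eq0 !signr_eq0 /=; case: (m) m_gt0.
have := rowE r0; rewrite eq1; case: (p) (p') eq1 => i s [i' s'] /= ->.
by case: (H_pm1 i' r0) => ->; case: s; case: s'.
Qed.

Lemma card_levels : #|levels| = (m.-1 * 2)%N.
Proof.
by rewrite card_imset ?cardsX ?cardsT ?card_bool ?cardsC1 ?card_ord //;
  apply: level_inj.
Qed.

Lemma card_level p : p.1 != r0 -> (#|level p| * 2)%N = m.
Proof.
move=> p1; have := row_dot p.1 r0; rewrite (negPf p1) mulr0n => bal.
suff: (#|level p| * 2)%:Z = m%:Z by case.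
rewrite -sum1_card big_mkcond /= PoszM (big_morph Posz PoszD (erefl 0)).
rewrite mulr_suml (eq_bigr (fun j => 1 + (-1) ^+ p.2 * (H p.1 j * H r0 j))).
  by rewrite big_split /= -mulr_sumr bal mulr0 addr0 sumr_const card_ord natz.
by move=> j _; rewrite H_r0 mulr1 -levelE; case: (j \in _).
Qed.

(** For three columns, the rows on which they agree are counted by a quadratic expression in the
    entries, whose sum is known from column orthogonality. *)
Lemma levels_design lam : (4 * lam.+1 = m)%N ->
  is_design 3 m (m %/ 2) lam levels.
Proof.
move=> mE; split; first by rewrite card_ord.
  move=> B /imsetP[p]; rewrite !inE andbT => p1 ->.
  by have := card_level p1; lia.
move=> X cardX.
have [a [b [c [ab ac bc XE]]]] :
    exists a b c, [/\ a != b, a != c, b != c & X = [set a; b; c]].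
  have /card_gt0P[a aX] : (0 < #|X|)%N by rewrite cardX.
  have: #|X :\ a| == 2 by have := cardsD1 a X; rewrite aX cardX; lia.
  case/cards2P=> b [c [bc Xa]]; exists a, b, c.
  have := setD1K aX; rewrite Xa => <-.
  have: a \notin X :\ a by rewrite !inE eqxx.
  by rewrite Xa !inE negb_or => /andP[-> ->]; rewrite bc setUA.
have -> : [set B in levels | X \subset B] =
          level @: [set p in setX [set~ r0] setT | X \subset level p].
  apply/setP=> B; apply/setIdP/imsetP => [[/imsetP[p pP ->] XB]|[p]].
    by exists p => //; rewrite inE pP.
  by rewrite inE => /andP[pP XB] ->; split=> //; apply: imset_f.
rewrite card_imset; last exact: level_inj.
pose N r : int := \sum_(s : bool) (X \subset level (r, s))%:Z.
(* If the three signs agree the right side is 4; otherwise the products sum to -1 and it is 0. *)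
have N4 r : 4%:Z * N r = 1 + H r a * H r b + H r a * H r c + H r b * H r c.
  rewrite /N big_bool /= XE !subUset !sub1set !inE.
  by case: (H_pm1 r a) => ->; case: (H_pm1 r b) => ->; case: (H_pm1 r c) => ->.
have sumN : 4%:Z * \sum_r N r = m%:Z.
  rewrite mulr_sumr; under eq_bigr do rewrite N4.
  rewrite !big_split /= !col_dot (negPf ab) (negPf ac) (negPf bc) !addr0.
  by rewrite sumr_const card_ord natz.
have : (#|[set p in setX [set~ r0] setT | X \subset level p]|%:Z =
        \sum_(r | r != r0) N r).
  rewrite pair_big_dep /= -sum1_card (big_morph Posz PoszD (erefl 0)).
  rewrite big_mkcond [RHS]big_mkcond; apply: eq_bigr => -[r s] _.
  by rewrite !inE andbT /=; case: eqP => //= _; case: (_ \subset _).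
(* The all-one row accounts for 4 of the total [m], leaving [4 * lam]. *)
move=> cardE; have := sumN; rewrite (bigD1 r0) //= -cardE mulrDr N4 !H_r0.
by rewrite !mulr1; move: #|[set p in _ | _]| => n; lia.
Qed.

End HadamardDesign.

(** * The blocks of D(q) as codewords of L(q) *)

Section Blocks.
Variable F : finFieldType.
Hypothesis two_neq0 : 2%:R != 0 :> F.

Lemma D_blocksE (r0 : 'I_(#|F|.+1 + #|F|.+1)) : val r0 = 0%N ->
  D_blocks F = levels (H_mx F) r0.
Proof.
move=> r00; apply/setP=> B; apply/setUP/imsetP => [[]/imsetP[r]|[[r s]]].
- rewrite inE => nr ->; exists (r, false) => //.
  by rewrite !inE andbT /= -(inj_eq val_inj) r00.
- rewrite inE => nr ->; exists (r, true) => //.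
  by rewrite !inE andbT /= -(inj_eq val_inj) r00.
rewrite !inE andbT /= -(inj_eq val_inj) r00 => nr ->.
by case: s; [right|left]; apply: imset_f; rewrite inE.
Qed.

Definition row_ones : 'I_(#|F|.+1 + #|F|.+1) := lshift _ ord0.

Lemma H_row_ones j : H_mx F row_ones j = 1.
Proof. exact: H_mx_first_row. Qed.

Lemma card_D_blocks : #|D_blocks F| = (4 * #|F| + 2)%N.
Proof.
rewrite (D_blocksE (r0 := row_ones)) // card_levels /=; first by lia.
- exact: H_pm1.
- exact: H_mulmx_tr.
Qed.

Lemma D_blocks_design (oddF : odd #|F|) :
  is_design 3 (2 * #|F| + 2) #|F|.+1 ((#|F| - 1) %/ 2) (D_blocks F).
Proof.
have mE : (4 * ((#|F| - 1) %/ 2).+1 = #|F|.+1 + #|F|.+1)%N by lia.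
rewrite (D_blocksE (r0 := row_ones)) //.
have := levels_design (H_pm1 two_neq0) (H_mulmx_tr two_neq0)
  (H_trmx_mul two_neq0) H_row_ones mE.
rewrite (_ : (_ %/ 2)%N = #|F|.+1); last by lia.
by rewrite (_ : (2 * #|F| + 2)%N = (#|F|.+1 + #|F|.+1)%N) //; lia.
Qed.

Lemma card_D_block B : B \in D_blocks F -> #|B| = #|F|.+1.
Proof.
rewrite (D_blocksE (r0 := row_ones)) // => /imsetP[p].
rewrite !inE andbT => p1 ->.
have := card_level (H_pm1 two_neq0) (H_mulmx_tr two_neq0)
  H_row_ones p1.
lia.
Qed.

Lemma L_codeP (c : 'rV['F_3]_(#|F|.+1 + #|F|.+1)) :
  reflect (exists x, c = row_mx x (x *m U_mx F 'F_3)) (c \in L_code F).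
Proof.
rewrite inE; apply: (iffP submxP) => -[x ->]; exists x;
  by rewrite mul_mx_row mulmx1.
Qed.

Lemma U_mx_intr (R : nzRingType) : U_mx F R = map_mx intr (U_mx F int).
Proof.
apply/matrixP=> i j; rewrite [RHS]mxE U_mxE !mxE.
case: (label i) (label j) => [a|] [b|] //=.
- by rewrite /chi subr_eq0; case: eqP => // _; case: is_square; rewrite ?rmorphN1.
- by case: is_square; rewrite ?oppr_eq0 oner_eq0 rmorphN1.
- by rewrite eqxx.
Qed.

Hypothesis q_mod3 : #|F| = 2 %[mod 3].

(** As [q = -1] in GF(3), [W^T *m W = - 1]; hence multiplying [(I, W)] by [I - W^T] and by [I + W^T]
    gives the two block rows of [H]. *)
Lemma H_row_in_L_code r : map_mx intr (row r (H_mx F)) \in L_code F.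
Proof.
have q_F3 : #|F|%:R = -1 :> 'F_3.
  by apply/val_inj; rewrite /= val_Fp_nat // q_mod3.
rewrite inE map_row; apply: submx_trans (row_sub _ _) _.
pose W := U_mx F 'F_3.
apply/submxP; exists (col_mx (1%:M - W^T) (1%:M + W^T)).
have gram : W^T *m W = - 1%:M.
  rewrite /W U_mx_intr map_trmx -map_mxM U_trmx_mul // map_scalar_mx /=.
  by rewrite -pmulrn q_F3 raddfN.
rewrite mul_col_mx !mul_mx_row !mulmx1 !(mulmxDl, mulNmx, mul1mx) gram.
rewrite /H_mx map_block_mx !(raddfD, raddfN) /= -map_trmx -U_mx_intr map_mx1.
by rewrite opprK.
Qed.

Lemma const1_in_L_code : const_mx 1 \in L_code F.
Proof.
have := H_row_in_L_code row_ones; rewrite (_ : map_mx _ _ = const_mx 1) //.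
by apply/rowP=> j; rewrite 2!mxE H_row_ones mxE.
Qed.

Lemma incidence_in_L_code B :
  B \in D_blocks F -> incidence_vector 'F_3 B \in L_code F.
Proof.
rewrite (D_blocksE (r0 := row_ones)) // => /imsetP[[r s] _ ->].
(* With [h] the signed row, [1 + h] is [2 = -1] on the level set and 0 off it. *)
have -> : incidence_vector 'F_3 (level (H_mx F) (r, s)) =
    - (const_mx 1 + (-1) ^+ s *: map_mx intr (row r (H_mx F))).
  move: (H_mx F) (H_pm1 two_neq0) => H Hpm.
  apply/rowP=> j; rewrite !mxE inE /=.
  by case: (Hpm r j) => ->; case: s; apply/val_inj.
have := const1_in_L_code; have := H_row_in_L_code r; rewrite !inE => hr h1.
by rewrite eqmx_opp addmx_sub ?scalemx_sub.
Qed.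

Definition half_weight_words : {set 'rV['F_3]_(#|F|.+1 + #|F|.+1)} :=
  [set c in L_code F | zero_one c && (hamming_weight c == #|F|.+1)].

Lemma incidence_inj (R : nzRingType) n : injective (@incidence_vector R n).
Proof.
move=> A B /rowP AB; apply/setP=> j; have := AB j; rewrite !mxE.
by case: (_ \in _); case: (_ \in _) => // /eqP;
  rewrite ?oner_eq0 // eq_sym oner_eq0.
Qed.

Lemma hamming_weight_incidence (R : nzRingType) n (B : {set 'I_n}) :
  hamming_weight (incidence_vector R B) = #|B|.
Proof.
rewrite /hamming_weight; congr #|pred_of_set _|; apply/setP=> j.
by rewrite inE mxE; case: (_ \in _); rewrite ?oner_eq0 ?eqxx.
Qed.

Lemma incidence_half_weight :
  [set incidence_vector 'F_3 B | B in D_blocks F] \subset half_weight_words.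
Proof.
apply/subsetP=> c /imsetP[B DB ->]; rewrite inE incidence_in_L_code //=.
rewrite hamming_weight_incidence card_D_block // eqxx andbT.
by apply/forallP=> j; rewrite mxE; case: (_ \in _); rewrite eqxx ?orbT.
Qed.

(** The incidence vectors already form a subset of [4q + 2] elements, so the upper bound forces
    equality. *)
Lemma half_weight_eq_incidence : (#|half_weight_words| <= 4 * #|F| + 2)%N ->
  half_weight_words = [set incidence_vector 'F_3 B | B in D_blocks F].
Proof.
move=> le_good; apply/esym/eqP; rewrite eqEcard incidence_half_weight.
by rewrite card_imset ?card_D_blocks //; apply: incidence_inj.
Qed.

End Blocks.

(** * Counting words without zero entries *)

(* Elements of GF(3) are coded by the naturals 0, 1, 2, so that the search below
   evaluates on constructors of [nat] only. *)
Definition trit (c : nat) : 'F_3 :=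
  match c with 0 => 0 | 1 => 1 | _ => -1 end.

Definition incr3 n := match n with 0 => 1 | 1 => 2 | _ => 0 end%N.
Definition decr3 n := match n with 0 => 2 | 1 => 0 | _ => 1 end%N.

(** The dot product over GF(3). It stops with the shorter list, so trailing zero coefficients may be
    omitted. *)
Fixpoint dot3 (cs w : seq nat) : nat :=
  match cs, w with
  | c :: cs', a :: w' =>
    match c, a with
    | 0, _ | _, 0 => dot3 cs' w'
    | 1, 1 | _.+2, _.+2 => incr3 (dot3 cs' w')
    | _, _ => decr3 (dot3 cs' w')
    end
  | _, _ => 0
  end%N.

(* A plan lists coordinates in an order of assignment.  An entry [(m, None)]
   leaves coordinate [m] free; in [(m, Some cs)] coordinate [m] is the linear
   combination, with coefficients [cs], of the earlier ones, most recent first. *)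
Definition plan := seq (nat * option (seq nat)).

Fixpoint sat (p : plan) (pre w : seq nat) : bool :=
  match p, w with
  | (_, o) :: p', a :: w' =>
    (if o is Some cs then dot3 cs pre == a else true) && sat p' (a :: pre) w'
  | [::], [::] => true
  | _, _ => false
  end.

(* Counts the words without zero entries extending [pre] (stored in reverse
   order) that satisfy [p] and have exactly [k] entries 1. *)
Fixpoint leaves (k : nat) (p : plan) (pre : seq nat) : nat :=
  match p with
  | [::] => if count_mem 1 pre == k then 1 else 0
  | (_, None) :: p' => leaves k p' (1 :: pre) + leaves k p' (2 :: pre)
  | (_, Some cs) :: p' =>
    match dot3 cs pre with
    | 0 => 0
    | 1 => leaves k p' (1 :: pre)
    | _ => leaves k p' (2 :: pre)
    end
  end%N.

Lemma dot3_lt3 cs w : (dot3 cs w < 3)%N.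
Proof.
by elim: cs w => [|[|[|c]] cs IH] [|[|[|a]] w] //=;
  case: (dot3 cs w) (IH w) => [|[|[|n]]].
Qed.

Lemma dot3_cons c cs a w :
  trit (dot3 (c :: cs) (a :: w)) = trit c * trit a + trit (dot3 cs w).
Proof.
by case: c a => [|[|c]] [|[|a]] /=; case: (dot3 cs w) => [|[|n]]; apply/val_inj.
Qed.

Lemma trit_inj : {in gtn 3 &, injective trit}.
Proof. by move=> [|[|[|i]]] [|[|[|j]]] // _ _ /(congr1 val). Qed.

Lemma trit_val (a : 'F_3) : trit a = a.
Proof. by apply/val_inj; case: a => -[|[|[|a]]]. Qed.

Section Linearity.
Variables (I : finType) (x : I -> 'F_3) (g : I -> nat -> nat) (f : nat -> nat).
Hypothesis fE : forall m, trit (f m) = \sum_i x i * trit (g i m).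

Lemma dot3_linear cs s :
  trit (dot3 cs (map f s)) = \sum_i x i * trit (dot3 cs (map (g i) s)).
Proof.
elim: cs s => [|c cs IH] [|m s]; try by rewrite big1 // => i _; rewrite mulr0.
rewrite dot3_cons IH fE mulr_sumr -big_split; apply: eq_bigr => i _ /=.
rewrite -[RHS]/(_ * trit (dot3 (c :: cs) (g i m :: _))).
by rewrite dot3_cons mulrDr mulrCA.
Qed.

Hypothesis f_lt3 : forall m, (f m < 3)%N.
Hypothesis g_lt3 : forall i m, (g i m < 3)%N.

(** The constraints of a plan are linear: checking them on the generators [g i] suffices for every
    combination [f]. *)
Lemma sat_linear p s :
  (forall i, sat p (map (g i) s) (map (g i \o fst) p)) ->
  sat p (map f s) (map (f \o fst) p).
Proof.
elim: p s => [//|[m o] p IH] s satg /=; apply/andP; split; last first.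
  by rewrite -map_cons; apply: IH => i; have /= /andP[] := satg i.
case: o satg => [cs|//] satg.
apply/eqP/trit_inj; rewrite ?inE ?dot3_lt3 ?f_lt3 //.
rewrite dot3_linear fE; apply: eq_bigr => i _.
by have /= /andP[/eqP->] := satg i.
Qed.
End Linearity.

(** Induction on the plan, splitting [s] by first letter; removing a common first letter keeps the
    words distinct. *)
Lemma leaves_bound k p pre (s : seq (seq nat)) : uniq s ->
  {in s, forall w, [/\ sat p pre w, all (mem [:: 1; 2]%N) w
                     & count_mem 1%N (rev w ++ pre) = k]} ->
  (size s <= leaves k p pre)%N.
Proof.
elim: p pre s => [|[m o] p IH] pre s Us sP /=.
  case: s Us sP => [//|w s] Us sP.
  have w0 : w = [::] by case: w sP {Us} => // a w /(_ _ (mem_head _ _)) [].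
  have [_ _] := sP w (mem_head _ _); rewrite w0 /= => ->; rewrite eqxx.
  case: s Us sP => // w' s /=; rewrite inE negb_or => /andP[/andP[ne _] _] sP.
  have [] := sP w'; first by rewrite !inE eqxx orbT.
  by case: w' ne {sP}; rewrite w0.
have split_head a :
    (size [seq w <- s | head 0%N w == a] <= leaves k p (a :: pre))%N.
  rewrite -(size_map behead); apply: IH.
    rewrite map_inj_in_uniq ?filter_uniq // => w w'; rewrite !mem_filter.
    move=> /andP[/eqP wa ws] /andP[/eqP w'a w's].
    have [+ _ _] := sP w ws; have [+ _ _] := sP w' w's.
    by case: w wa {ws} => //= b w ->; case: w' w'a {w's} => //= b' w' -> _ _ ->.
  move=> w /mapP[[|b w']]; rewrite mem_filter => /andP[/eqP /= wa ws] ->.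
    by have [] := sP _ ws.
  have [] := sP _ ws; rewrite wa /= => /andP[_ satw] /andP[_ w12] <-; split=> //.
  by rewrite rev_cons cat_rcons.
have size12 : size s = (size [seq w <- s | head 0%N w == 1%N] +
                        size [seq w <- s | head 0%N w == 2%N])%N.
  rewrite !size_filter -count_predUI (_ : count (predI _ _) _ = 0%N); last first.
    apply/eqP; rewrite -leqn0 leqNgt -has_count.
    by apply/hasPn=> w _ /=; case: eqP => // ->.
  rewrite addn0; apply/esym/eqP; rewrite -all_count; apply/allP=> w ws /=.
  have [] := sP w ws; case: w {ws} => // a w _ /= /andP[+ _] _.
  by rewrite !inE.
case: o sP => [cs|] sP; last by rewrite size12 leq_add.
have headE w : w \in s -> head 0%N w = dot3 cs pre.
  by move=> ws; have [] := sP w ws; case: w {ws} => //= a w /andP[/eqP ->].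
have only a : dot3 cs pre = a -> a != 0 -> (size s <= leaves k p (a :: pre))%N.
  move=> e _.
  rewrite -[X in (size X <= _)%N](_ : [seq w <- s | head 0%N w == a] = s) //.
  by apply/all_filterP/allP=> w /headE ->; rewrite e.
(* A forced letter 1 or 2 begins every word of [s]; a forced 0 is not allowed, so then [s] is
   empty. *)
have := dot3_lt3 cs pre; case e: dot3 => [|[|[|//]]] _; try exact: only.
rewrite size12 !size_filter !(eq_in_count (a2 := pred0)) ?count_pred0 //;
  by move=> w /headE /= ->; rewrite e.
Qed.

Definition squares_mod (q : nat) : seq nat :=
  [seq (i * i %% q)%N | i <- iota 0 q].

(* Rows and columns are numbered by 0 for the label oo and [a.+1] for the field
   element [a%:R]; [sq] stands for the list of squares mod [q]. *)
Definition U_code (q : nat) (sq : seq nat) (i j : nat) : nat :=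
  match i, j with
  | 0, 0 => 0
  | 0, _ => 1
  | _, 0 => 2
  | a.+1, b.+1 =>
    if a == b then 0 else if (a + (q - b)) %% q \in sq then 1 else 2
  end%N.

Definition gen_code (q : nat) (sq : seq nat) (i m : nat) : nat :=
  (if m < q.+1 then nat_of_bool (i == m) else U_code q sq i (m - q.+1))%N.

(* The first coordinate is fixed to 1: this halves the search and is compensated
   by the symmetry [c |-> 1 - c] of the code. *)
Definition certificate (q : nat) (p : plan) : bool :=
  if p is (_, None) :: p' then
    let sq := squares_mod q in
    [&& perm_eq (map fst p) (iota 0 (q.+1 + q.+1)),
        all (fun i => sat p [::] (map (gen_code q sq i \o fst) p)) (iota 0 q.+1)
      & (leaves q.+1 p' [:: 1] <= 2 * q + 1)%N]
  else false.

(** * From the numerical certificate to the code over a field of prime order *)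

Section PrimeField.
Variables (F : finFieldType) (q : nat).
Hypotheses (pr_q : prime q) (cardF : #|F| = q).

Lemma pchar_card_prime : q \in [pchar F].
Proof. by apply: (@card_finPcharP _ _ 1); rewrite ?expn1. Qed.

Lemma natr_eq_mod a b : (a%:R == b%:R :> F) = (a == b %[mod q]).
Proof.
wlog le_ab : a b / (a <= b)%N => [th|].
  by case/orP: (leq_total a b) => /th //; rewrite eq_sym => ->; rewrite eq_sym.
rewrite eq_sym [RHS]eq_sym eqn_mod_dvd // (dvdn_pcharf pchar_card_prime) natrB //.
by rewrite subr_eq0.
Qed.

Lemma natr_surj (a : F) : exists2 i, (i < q)%N & a = i%:R.
Proof.
have inj : injective (fun i : 'I_q => i%:R : F).
  move=> i j /eqP; rewrite natr_eq_mod !modn_small // => /eqP; exact: val_inj.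
(* An injection between sets of the same size [q] is a bijection. *)
have [g _ gK] := inj_card_bij inj (eq_leq (etrans cardF (esym (card_ord q)))).
by exists (g a); rewrite ?gK.
Qed.

Lemma is_square_natr k : is_square (k%:R : F) = (k %% q \in squares_mod q)%N.
Proof.
apply/existsP/mapP => [[b]|[i _ e]].
  have [i lt_iq ->] := natr_surj b; rewrite -natrX natr_eq_mod => /eqP e.
  by exists i; rewrite ?mem_iota // e mulnn.
by exists i%:R; rewrite -natrX natr_eq_mod e mulnn.
Qed.

(** The canonical enumeration of [F] need not follow the numbering by residues; this translates the
    numbering into matrix indices. *)
Definition ord_of_code (k : nat) : 'I_#|F|.+1 :=
  if k is k'.+1 then lift ord0 (enum_rank (k'%:R : F)) else ord0.

Lemma label_ord_of_code k :
  label (ord_of_code k) = if k is k'.+1 then Some k'%:R else None :> option F.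
Proof.
by case: k => [|k]; rewrite /label ?unlift_none ?liftK //= enum_rankK.
Qed.

Lemma ord_of_code_inj : {in gtn q.+1 &, injective ord_of_code}.
Proof.
move=> i j lti ltj /(congr1 (@label F)); rewrite !label_ord_of_code.
case: i j lti ltj => [|i] [|j] //; rewrite !inE !ltnS => lti ltj [] /eqP.
by rewrite natr_eq_mod !modn_small // => /eqP ->.
Qed.

Lemma U_mx_code i j : (i < q.+1)%N -> (j < q.+1)%N ->
  U_mx F 'F_3 (ord_of_code i) (ord_of_code j) =
  trit (U_code q (squares_mod q) i j).
Proof.
move=> lti ltj; rewrite !mxE !label_ord_of_code.
case: i j lti ltj => [|i] [|j] //=; rewrite !ltnS => lti ltj.
  by case: is_square.
have := is_square_natr (i + (q - j)).
rewrite natrD natrB ?(ltnW ltj) // (pcharf0 pchar_card_prime) sub0r => ->.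
rewrite natr_eq_mod (modn_small lti) (modn_small ltj); case: (i == j) => //.
by case: (_ \in _).
Qed.

Definition coord_of_code (m : nat) : 'I_(#|F|.+1 + #|F|.+1) :=
  if (m < q.+1)%N then lshift _ (ord_of_code m)
  else rshift _ (ord_of_code (m - q.+1)).

Lemma coord_of_code_inj : {in gtn (q.+1 + q.+1) &, injective coord_of_code}.
Proof.
move=> i j; rewrite !inE /coord_of_code => lti ltj.
case: ifP => ci; case: ifP => cj; move/eqP;
  rewrite ?eq_lshift ?eq_rshift ?eq_lrshift ?eq_rlshift // => /eqP.
  exact: ord_of_code_inj.
move/ord_of_code_inj; rewrite !inE; lia.
Qed.

Lemma perm_coords s : perm_eq s (iota 0 (q.+1 + q.+1)) ->
  perm_eq (map coord_of_code s) (enum 'I_(#|F|.+1 + #|F|.+1)).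
Proof.
move=> ps; have s_lt m : m \in s -> (m < q.+1 + q.+1)%N.
  by rewrite (perm_mem ps) mem_iota.
have Us : uniq (map coord_of_code s).
  rewrite map_inj_in_uniq ?(perm_uniq ps) ?iota_uniq //.
  move=> i j /s_lt lti /s_lt ltj.
  exact: coord_of_code_inj.
apply: uniq_perm => //; rewrite ?enum_uniq //.
have [] // := uniq_min_size Us (s2 := enum 'I_(#|F|.+1 + #|F|.+1)).
  by move=> j _; rewrite mem_enum.
by rewrite -cardE card_ord size_map (perm_size ps) size_iota cardF.
Qed.

(** The generator matrix is systematic, so the coefficients of [v] are its own first [q + 1]
    coordinates. *)
Lemma codeword_coord v m : v \in L_code F -> (m < q.+1 + q.+1)%N ->
  v 0 (coord_of_code m) =
  \sum_(i < q.+1) v 0 (coord_of_code i) * trit (gen_code q (squares_mod q) i m).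
Proof.
have ordE (i : 'I_q.+1) : coord_of_code i = lshift _ (ord_of_code i).
  by rewrite /coord_of_code ltn_ord.
case/L_codeP=> x -> ltm; rewrite /coord_of_code /gen_code; case: ifP => cm.
  rewrite row_mxEl (bigD1 (Ordinal cm)) //= cm row_mxEl eqxx mulr1 big1 ?addr0 //.
  move=> i; rewrite -(inj_eq val_inj) /= => /negPf ->.
  by rewrite mulr0.
have cm' : (m - q.+1 < q.+1)%N by lia.
rewrite row_mxEr mxE.
have inj : injective (fun i : 'I_q.+1 => ord_of_code i).
  by move=> i j /ord_of_code_inj e; apply/val_inj/e; rewrite inE /= ltn_ord.
rewrite (reindex (fun i : 'I_q.+1 => ord_of_code i)) /=; last first.
  by apply/onW_bij/(inj_card_bij inj); rewrite !card_ord cardF.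
by apply: eq_bigr => i _; rewrite ltn_ord row_mxEl U_mx_code.
Qed.

Definition word (p : plan) (v : 'rV['F_3]_(#|F|.+1 + #|F|.+1)) : seq nat :=
  map (fun j => v 0 j : nat) (map coord_of_code (map fst p)).

Lemma sat_word p v : perm_eq (map fst p) (iota 0 (q.+1 + q.+1)) ->
  all (fun i => sat p [::] (map (gen_code q (squares_mod q) i \o fst) p))
    (iota 0 q.+1) ->
  v \in L_code F -> sat p [::] (word p v).
Proof.
move=> pp /allP satg vL.
(* [f] and [g] are cut off to 0 beyond the length because [sat_linear] asks for linearity at every
   [m]. *)
pose f m : nat :=
  if (m < q.+1 + q.+1)%N then v 0 (coord_of_code m) : nat else 0%N.
pose g (i : 'I_q.+1) m : nat :=
  if (m < q.+1 + q.+1)%N then gen_code q (squares_mod q) i m else 0%N.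
have lt_p m : m \in map fst p -> (m < q.+1 + q.+1)%N.
  by rewrite (perm_mem pp) mem_iota.
have -> : word p v = map (f \o fst) p.
  rewrite /word -!map_comp; apply/eq_in_map => m mp /=.
  by rewrite /f lt_p ?map_f.
pose x (i : 'I_q.+1) := v 0 (coord_of_code i).
apply: (sat_linear (x := x) (g := g) _ _ (s := [::])).
- move=> m; rewrite /f /g; case: ifP => ltm; last first.
    by rewrite big1 // => i _; rewrite mulr0.
  by rewrite trit_val codeword_coord.
- by move=> m; rewrite /f; case: ifP => // _; apply: (ltn_ord (v 0 _)).
move=> i; rewrite (_ : map _ p = map (gen_code q (squares_mod q) i \o fst) p).
  by apply: satg; rewrite mem_iota ltn_ord.
by apply/eq_in_map => m mp /=; rewrite /g lt_p ?map_f.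
Qed.

Lemma word_inj p : perm_eq (map fst p) (iota 0 (q.+1 + q.+1)) ->
  injective (word p).
Proof.
move=> pp v v' /eq_in_map e; apply/rowP=> j; apply/val_inj/e.
by rewrite (perm_mem (perm_coords pp)) mem_enum.
Qed.

Lemma count_word p v a : perm_eq (map fst p) (iota 0 (q.+1 + q.+1)) ->
  count_mem a (word p v) = #|[set j | v 0 j == a :> nat]|.
Proof.
move=> pp; rewrite /word count_map (permP (perm_coords pp)).
rewrite -sum1_count big_enum_cond -sum1_card.
by apply: eq_bigl => j; rewrite inE.
Qed.

Hypothesis q_mod3 : #|F| = 2 %[mod 3].
Hypothesis q_odd : odd q.

Lemma two_neq0 : 2%:R != 0 :> F.
Proof.
rewrite -[0]/(0%:R) natr_eq_mod mod0n modn_small //.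
by have := prime_gt1 pr_q; case: (q) q_odd => [|[|[]]].
Qed.

(** The all-one word lies in the code, and complementing preserves the weight [q + 1], half the
    length. *)
Lemma half_weight_compl c :
  c \in half_weight_words F -> const_mx 1 - c \in half_weight_words F.
Proof.
rewrite !inE => /and3P[cL /forallP c01 /eqP wc]; apply/and3P; split.
- have := const1_in_L_code two_neq0 q_mod3; rewrite inE => h1.
  by rewrite addmx_sub // eqmx_opp.
- apply/forallP=> j; rewrite !mxE.
  by case/orP: (c01 j) => /eqP->; rewrite ?subr0 ?subrr eqxx ?orbT.
rewrite /hamming_weight (_ : [set j | _] = ~: [set j | c 0 j != 0]).
  by rewrite cardsCs setCK card_ord -/(hamming_weight c) wc addnK.
apply/setP=> j; rewrite !inE !mxE negbK.
by case/orP: (c01 j) => /eqP->; rewrite ?subr0 ?subrr.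
Qed.

Lemma card_half_weight_le p :
  certificate q p -> (#|half_weight_words F| <= 4 * q + 2)%N.
Proof.
case: p => // -[m0 [//|]] p' /=; set p := (m0, None) :: p'.
rewrite -[m0 :: _]/(map fst p) => /and3P[pp].
(* The free first coordinate imposes nothing; this restores the unsimplified form for the whole
   plan. *)
rewrite -[fun i => sat p' _ _]
  /(fun i => sat p [::] (map (gen_code q (squares_mod q) i \o fst) p)).
move=> satg leaf.
pose j0 := coord_of_code m0.
(* For these [c] the word [1 + c] has first letter 1, as in the certified search. *)
pose G0 := [set c in half_weight_words F | c 0 j0 == 0].
have le0 : (#|G0| <= 2 * q + 1)%N.
  apply: leq_trans leaf.
  pose wd c := behead (word p (const_mx 1 + c)).
  have headE c : c \in G0 -> word p (const_mx 1 + c) = 1%N :: wd c.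
    rewrite inE => /andP[_ /eqP c0]; rewrite /wd /word /= -/j0.
    by rewrite !mxE c0 addr0.
  rewrite cardE -(size_map wd); apply: leaves_bound.
    rewrite map_inj_in_uniq ?enum_uniq // => c c'.
    rewrite !mem_enum => cG c'G e.
    apply: (addrI (const_mx 1)); apply: (word_inj pp).
    by rewrite !headE // e.
  move=> w /mapP[c]; rewrite mem_enum => cG ->.
  have /setIdP[] := cG; rewrite inE => /and3P[cL /forallP c01 /eqP wc] c0.
  have v12 j : (const_mx 1 + c) 0 j = if c 0 j == 0 then 1 else -1.
    by rewrite !mxE; case/orP: (c01 j) => /eqP->; apply/val_inj.
  split.
  - have : sat p [::] (word p (const_mx 1 + c)).
      apply: sat_word => //; have := const1_in_L_code two_neq0 q_mod3.
      by move: cL; rewrite !inE => *; apply: addmx_sub.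
    by rewrite headE.
  - have : all (mem [:: 1; 2]%N) (word p (const_mx 1 + c)).
      by rewrite all_map; apply/allP=> j _ /=; rewrite v12; case: ifP.
    by rewrite headE //= => /andP[].
  rewrite count_cat count_rev addnC.
  have -> : (count_mem 1%N [:: 1%N] + count_mem 1%N (wd c) =
             count_mem 1%N (word p (const_mx 1 + c)%R))%N by rewrite headE.
  (* The entries 1 of [1 + c] are the zeros of [c], of which there are [2q + 2 - (q + 1)]. *)
  rewrite count_word // (_ : [set j | _] = ~: [set j | c 0 j != 0]).
    by rewrite cardsCs setCK card_ord -/(hamming_weight c) wc cardF addnK.
  by apply/setP=> j; rewrite !inE v12 negbK; case: ifP.
(* Complementing maps the words with entry 1 at [j0] injectively into [G0], so the total is at most
   twice [2q + 1]. *)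
have le1 : (#|half_weight_words F :\: G0| <= #|G0|)%N.
  have inj : injective
      (fun c : 'rV['F_3]_(#|F|.+1 + #|F|.+1) => const_mx 1 - c).
    by move=> c c' /addrI/oppr_inj.
  rewrite -(card_imset _ inj).
  apply/subset_leq_card/subsetP=> _ /imsetP[c + ->].
  rewrite inE => /andP[cG0 cG]; rewrite inE half_weight_compl //=.
  have : c 0 j0 != 0 by move: cG0; rewrite inE cG.
  move: cG; rewrite inE => /and3P[_ /forallP/(_ j0) + _].
  by rewrite !mxE => /orP[] /eqP->; rewrite ?eqxx ?subrr.
have sub : G0 \subset half_weight_words F by apply/subsetP=> c /setIdP[].
by rewrite -(cardsID G0) (setIidPr sub); lia.
Qed.
End PrimeField.

Local Close Scope ring_scope.

(* Each order runs greedily through the supports of strongly overlapping words of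
   minimum weight, so that dependent coordinates occur early and the search tree
   stays small (about 3 million nodes for q = 23). *)
Definition plan5 : plan :=
  [:: (0, None); (1, None); (2, None); (6, None); (9, None); (11, Some [:: 2;
  1; 1; 1; 2]); (4, None); (8, Some [:: 2; 0; 2; 2; 0; 2; 2]); (10, Some [::
  0; 2; 0; 0; 2; 1; 1; 1]); (5, Some [:: 0; 0; 1; 0; 2; 0; 1; 2; 1]); (7, Some
  [:: 0; 0; 0; 2; 0; 1; 1; 1; 2]); (3, Some [:: 0; 0; 0; 0; 1; 0; 1; 2; 1; 0;
  2])]%N.

Definition plan11 : plan :=
  [:: (0, None); (3, None); (5, None); (9, None); (14, None); (15, None); (16,
  None); (21, None); (23, Some [:: 2; 1; 1; 1; 2; 2; 2; 2]); (1, None); (2,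
  None); (17, Some [:: 1; 2; 0; 0; 2; 1; 2; 2; 0; 1; 2]); (12, None); (22,
  Some [:: 2; 0; 2; 1; 0; 0; 0; 2; 2; 2; 1; 1]); (8, Some [:: 0; 2; 0; 2; 0;
  0; 2; 1; 0; 2; 0; 1; 2; 1]); (10, None); (19, Some [:: 2; 0; 0; 2; 0; 1; 1;
  0; 0; 2; 2; 1; 2; 2; 2; 2]); (7, Some [:: 0; 2; 0; 0; 1; 0; 2; 2; 0; 2; 0;
  0; 0; 1; 0; 2; 1]); (18, Some [:: 0; 0; 1; 0; 0; 2; 0; 0; 0; 0; 1; 1; 1; 0;
  0; 2; 1; 1]); (13, Some [:: 0; 0; 0; 1; 0; 0; 0; 0; 0; 1; 0; 1; 1; 1; 2; 1;
  0; 0; 2]); (4, Some [:: 0; 0; 0; 0; 2; 0; 0; 2; 0; 2; 2; 0; 1; 2; 0; 2; 2;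
  2; 1; 1]); (11, Some [:: 0; 0; 0; 0; 0; 2; 0; 0; 1; 0; 2; 0; 0; 0; 0; 1; 0;
  2; 2; 1; 2]); (20, Some [:: 0; 0; 0; 0; 0; 0; 2; 0; 0; 0; 0; 2; 1; 0; 1; 1;
  0; 0; 0; 2; 2; 2]); (6, Some [:: 0; 0; 0; 0; 0; 0; 0; 2; 0; 0; 2; 0; 0; 1;
  0; 1; 0; 2; 2; 0; 0; 2; 1])]%N.

Definition plan17 : plan :=
  [:: (0, None); (7, None); (8, None); (17, None); (18, None); (22, None);
  (24, None); (26, None); (28, None); (30, None); (32, None); (33, Some [:: 1;
  2; 2; 1; 1; 1; 2; 1; 2; 1; 2]); (6, None); (20, None); (23, None); (25, Some
  [:: 2; 2; 1; 0; 1; 1; 0; 1; 0; 1; 0; 2; 1; 2; 2]); (1, None); (4, Some [::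
  1; 0; 1; 0; 2; 0; 0; 0; 2; 2; 2; 1; 2; 1; 1; 0; 1]); (2, None); (29, Some
  [:: 2; 0; 2; 0; 2; 0; 0; 0; 0; 2; 1; 2; 2; 1; 2; 2; 0; 1]); (16, None); (34,
  Some [:: 2; 0; 2; 0; 1; 0; 0; 0; 1; 0; 2; 0; 1; 0; 0; 2; 1; 0; 1; 1; 2]);
  (10, Some [:: 0; 1; 0; 1; 0; 1; 0; 0; 2; 2; 0; 2; 1; 2; 0; 1; 2; 0; 2; 1; 2;
  2]); (3, Some [:: 0; 0; 2; 0; 1; 0; 2; 0; 1; 2; 1; 0; 0; 2; 2; 0; 1; 0; 1;
  2; 2; 2; 1]); (11, None); (31, Some [:: 1; 0; 0; 0; 2; 0; 0; 0; 2; 0; 1; 1;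
  2; 0; 0; 1; 2; 0; 2; 2; 2; 0; 2; 1; 1]); (19, Some [:: 0; 1; 0; 0; 0; 2; 0;
  2; 0; 2; 0; 2; 0; 0; 0; 2; 1; 2; 2; 0; 0; 2; 2; 2; 2; 1]); (35, Some [:: 0;
  0; 1; 0; 0; 0; 2; 0; 1; 0; 2; 0; 2; 0; 2; 0; 1; 1; 1; 2; 1; 1; 0; 0; 0; 1;
  1]); (21, Some [:: 0; 0; 0; 1; 0; 0; 0; 2; 0; 2; 0; 0; 0; 0; 1; 1; 0; 2; 0;
  2; 2; 1; 2; 2; 1; 2; 1]); (9, Some [:: 0; 0; 0; 0; 1; 0; 0; 0; 1; 0; 2; 0;
  2; 0; 2; 2; 0; 0; 2; 0; 1; 1; 1; 1; 0; 2; 0; 2; 2]); (13, Some [:: 0; 0; 0;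
  0; 0; 2; 0; 0; 0; 2; 0; 0; 0; 2; 0; 0; 0; 2; 0; 2; 2; 2; 0; 0; 0; 1; 1; 2;
  1]); (27, Some [:: 0; 0; 0; 0; 0; 0; 2; 0; 0; 0; 2; 0; 0; 0; 0; 0; 2; 1; 2;
  0; 2; 0; 0; 1; 1; 1; 1; 1; 2; 2; 2]); (12, Some [:: 0; 0; 0; 0; 0; 0; 0; 2;
  0; 0; 0; 0; 0; 0; 0; 2; 0; 0; 2; 1; 0; 2; 2; 1; 2; 2; 2; 2; 0; 2; 1; 2]);
  (14, Some [:: 0; 0; 0; 0; 0; 0; 0; 0; 2; 0; 0; 0; 0; 0; 1; 0; 2; 0; 1; 1; 0;
  0; 1; 2; 2; 0; 1; 2; 2; 0; 1; 2; 2]); (5, Some [:: 0; 0; 0; 0; 0; 0; 0; 0;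
  0; 2; 0; 0; 0; 2; 0; 1; 0; 1; 0; 0; 2; 0; 0; 2; 0; 0; 0; 2; 1; 2; 0; 0; 2;
  2]); (15, Some [:: 0; 0; 0; 0; 0; 0; 0; 0; 0; 0; 2; 0; 0; 0; 0; 0; 2; 0; 1;
  0; 1; 1; 0; 0; 1; 0; 0; 1; 2; 0; 1; 0; 2; 2])]%N.

Definition plan23 : plan :=
  [:: (0, None); (3, None); (10, None); (16, None); (18, None); (20, None);
  (27, None); (28, None); (29, None); (31, None); (36, None); (39, None); (44,
  None); (46, None); (47, Some [:: 1; 2; 2; 1; 1; 1; 1; 2; 2; 1; 1; 1; 1; 2]);
  (6, None); (13, None); (25, None); (37, None); (38, Some [:: 1; 1; 1; 2; 0;
  0; 0; 0; 2; 0; 2; 1; 2; 1; 2; 1; 1; 1; 1]); (1, None); (9, Some [:: 2; 0; 2;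
  2; 1; 2; 0; 1; 1; 0; 0; 2; 0; 2; 1; 2; 2; 0; 0; 1; 1]); (15, None); (23,
  Some [:: 2; 0; 2; 0; 2; 0; 2; 0; 0; 2; 2; 2; 2; 0; 2; 1; 2; 1; 0; 0; 2; 1]);
  (24, None); (42, Some [:: 1; 0; 0; 0; 0; 0; 0; 1; 2; 1; 0; 2; 0; 2; 2; 2; 1;
  1; 0; 0; 2; 0; 2; 1; 2]); (30, None); (41, Some [:: 2; 0; 0; 0; 2; 0; 1; 0;
  0; 2; 1; 2; 0; 2; 1; 2; 1; 1; 0; 1; 2; 2; 2; 2; 0; 0; 2]); (14, None); (32,
  Some [:: 2; 0; 2; 0; 1; 0; 1; 0; 2; 0; 0; 1; 0; 0; 0; 1; 1; 2; 1; 0; 2; 1;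
  1; 0; 1; 1; 0; 1; 1]); (34, Some [:: 0; 2; 0; 0; 0; 1; 0; 1; 0; 0; 0; 2; 1;
  1; 1; 0; 0; 1; 1; 2; 1; 1; 1; 2; 0; 0; 2; 0; 1; 1]); (26, Some [:: 0; 0; 2;
  0; 2; 0; 2; 0; 2; 0; 0; 0; 2; 2; 1; 0; 0; 2; 0; 0; 0; 1; 2; 0; 1; 1; 1; 2;
  2; 2; 1]); (11, Some [:: 0; 0; 0; 2; 0; 1; 0; 0; 0; 2; 0; 1; 0; 0; 1; 0; 2;
  0; 1; 0; 2; 0; 0; 2; 2; 1; 0; 0; 0; 1; 2; 2]); (8, None); (17, Some [:: 1;
  0; 0; 0; 0; 0; 0; 1; 0; 1; 0; 0; 0; 1; 0; 2; 2; 0; 1; 0; 2; 2; 1; 0; 0; 1;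
  0; 0; 1; 0; 0; 0; 2; 1]); (45, Some [:: 0; 1; 0; 0; 0; 0; 2; 0; 2; 0; 2; 0;
  0; 0; 1; 0; 0; 1; 0; 0; 0; 0; 2; 2; 0; 0; 0; 0; 1; 1; 1; 2; 0; 2; 2]); (40,
  Some [:: 0; 0; 1; 0; 0; 0; 0; 0; 0; 1; 0; 2; 0; 2; 0; 0; 0; 1; 1; 2; 0; 0;
  2; 0; 2; 1; 0; 0; 2; 0; 1; 2; 0; 2]); (43, Some [:: 0; 0; 0; 1; 0; 0; 0; 0;
  0; 0; 2; 0; 0; 0; 2; 0; 2; 0; 0; 1; 0; 2; 0; 1; 2; 0; 1; 1; 0; 1; 1; 0; 0;
  1; 1]); (2, Some [:: 0; 0; 0; 0; 2; 0; 0; 0; 0; 2; 0; 2; 0; 1; 0; 0; 0; 0;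
  0; 0; 1; 1; 0; 0; 0; 0; 2; 2; 1; 2; 0; 2; 1; 0; 2; 1]); (22, Some [:: 0; 0;
  0; 0; 0; 2; 0; 0; 0; 0; 0; 0; 0; 0; 2; 0; 1; 0; 2; 0; 2; 0; 2; 2; 0; 2; 2;
  1; 2; 2; 1; 2; 0; 2; 2; 1; 2; 1; 1]); (5, Some [:: 0; 0; 0; 0; 0; 0; 2; 0;
  0; 0; 0; 1; 0; 2; 0; 0; 0; 1; 0; 2; 0; 2; 0; 1; 0; 0; 0; 1; 1; 2; 0; 2; 2;
  2; 2; 0; 2; 2; 0; 1]); (7, Some [:: 0; 0; 0; 0; 0; 0; 0; 1; 0; 0; 0; 0; 2;
  0; 2; 0; 1; 0; 2; 0; 2; 0; 1; 0; 1; 2; 0; 2; 0; 0; 0; 2; 1; 1; 0; 1; 1; 2;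
  0; 1]); (35, Some [:: 0; 0; 0; 0; 0; 0; 0; 0; 1; 0; 0; 0; 0; 2; 0; 0; 0; 2;
  0; 0; 0; 1; 0; 2; 0; 2; 2; 0; 2; 0; 1; 0; 0; 2; 1; 2; 2; 2; 2; 1; 1]); (4,
  Some [:: 0; 0; 0; 0; 0; 0; 0; 0; 0; 2; 0; 0; 0; 0; 2; 0; 0; 0; 0; 0; 0; 0;
  0; 0; 2; 1; 2; 0; 0; 0; 2; 2; 0; 0; 2; 2; 1; 0; 1; 1; 1; 1]); (33, Some [::
  0; 0; 0; 0; 0; 0; 0; 0; 0; 0; 2; 0; 0; 0; 0; 2; 0; 0; 0; 1; 0; 2; 0; 2; 0;
  0; 0; 2; 2; 0; 1; 2; 0; 0; 1; 0; 1; 0; 2; 1; 1; 2; 2; 2]); (21, Some [:: 0;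
  0; 0; 0; 0; 0; 0; 0; 0; 0; 0; 2; 0; 0; 0; 0; 2; 0; 1; 0; 2; 0; 1; 0; 0; 0;
  1; 1; 2; 1; 0; 1; 2; 2; 0; 2; 1; 2; 1; 0; 2; 0; 2; 2; 1]); (19, Some [:: 0;
  0; 0; 0; 0; 0; 0; 0; 0; 0; 0; 0; 1; 0; 0; 0; 0; 1; 0; 2; 0; 1; 0; 0; 0; 0;
  0; 0; 2; 2; 1; 0; 1; 0; 0; 2; 1; 1; 2; 0; 2; 2; 2; 1; 0; 1]); (12, Some [::
  0; 0; 0; 0; 0; 0; 0; 0; 0; 0; 0; 0; 0; 1; 0; 0; 0; 0; 2; 0; 1; 0; 0; 0; 2;
  0; 2; 0; 1; 2; 0; 0; 0; 0; 0; 2; 2; 2; 0; 2; 2; 2; 1; 1; 2; 0; 1])]%N.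

(** * Evaluation of the four certificates, and the conclusion *)

Lemma certificate5 : certificate 5 plan5. Proof. by vm_compute. Qed.
Lemma certificate11 : certificate 11 plan11. Proof. by vm_compute. Qed.
Lemma certificate17 : certificate 17 plan17. Proof. by vm_compute. Qed.
Lemma certificate23 : certificate 23 plan23. Proof. by vm_compute. Qed.

Theorem theorem2 (F : finFieldType) (q : nat)
    (hq : q \in [:: 5; 11; 17; 23]) (hF : #|F| = q) :
  let good := [set c in L_code F | zero_one c && (hamming_weight c == q.+1)] in
  [/\ #|good| = 4 * q + 2,
      is_design 3 (2 * q + 2) q.+1 ((q - 1) %/ 2) (D_blocks F)
    & forall c, c \in good ->
        exists2 B, B \in D_blocks F & c = incidence_vector 'F_3 B].
Proof.
subst q => good.
have [pr_q odd_q q_mod3 [p cert]] :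
    [/\ prime #|F|, odd #|F|, #|F| = 2 %[mod 3] & exists p, certificate #|F| p].
  move: hq; rewrite !inE => /or4P[] /eqP->; split=> //.
  - by exists plan5; apply: certificate5.
  - by exists plan11; apply: certificate11.
  - by exists plan17; apply: certificate17.
  - by exists plan23; apply: certificate23.
have two_neq0F := two_neq0 pr_q erefl odd_q.
have bound := card_half_weight_le pr_q erefl q_mod3 odd_q cert.
have goodE := half_weight_eq_incidence two_neq0F q_mod3 bound.
split; last 1 first.
- by move=> c; rewrite [good]goodE => /imsetP.
- rewrite [good]goodE card_imset ?card_D_blocks //; exact: incidence_inj.
- exact: D_blocks_design.
Qed.
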